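(* Let $n\ge 1$, let $d=(d_1,\dots,d_n)\in\mathbb{N}_0^n$ and $\ell=(\ell_1,\dots,\ell_n)\in 2\mathbb{N}_0^n$. If $(\gamma_\alpha)_{\alpha\in\mathbb{N}_0^n}\in M_n$, then the multisequence $(\tilde\gamma_\alpha)_{\alpha\in\mathbb{N}_0^n}$ defined by $\tilde\gamma_\alpha=\gamma_{d\alpha+\ell}$ also belongs to $M_n$.
   Context: $\mathbb{N}_0$ is the set of nonnegative integers. An $n$-multisequence is a family of numbers $(\gamma_\alpha)_{\alpha\in\mathbb{N}_0^n}$ indexed by multi-indices. For $d,\alpha\in\mathbb{N}_0^n$, $d\alpha=(d_1\alpha_1,\dots,d_n\alpha_n)$ is the componentwise product. $M_n$ denotes the set of moment $n$-multisequences: real-valued $(\gamma_\alpha)_{\alpha\in\mathbb{N}_0^n}$ for which there is a nonnegative Borel measure $\sigma$ on $\mathbb{R}^n$ with $\int_{\mathbb{R}^n}|x|^\alpha\,d\sigma(x)<\infty$ for all $\alpha\in\mathbb{N}_0^n$ (where $|x|^\alpha=|x_1|^{\alpha_1}\cdots|x_n|^{\alpha_n}$) and $\gamma_\alpha=\int_{\mathbb{R}^n}x^\alpha\,d\sigma(x)$ for all $\alpha\in\mathbb{N}_0^n$. *)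

(* Defs.v *)
From HB Require Import structures.
From mathcomp Require Import all_boot all_order all_algebra.
From mathcomp Require Import all_classical all_reals all_analysis.
Import Order.TTheory GRing.Theory Num.Theory.
Import numFieldNormedType.Exports.

Set Implicit Arguments.
Unset Strict Implicit.
Unset Printing Implicit Defensive.

Local Open Scope classical_set_scope.
Local Open Scope ring_scope.

Definition multiindex (n : nat) : Type := {ffun 'I_n -> nat}.

(* [affine_mindex d a l] is d a + l, with d a the componentwise product. *)
Definition affine_mindex (n : nat) (d a l : multiindex n) : multiindex n :=
  [ffun i => (d i * a i + l i)%N].

Definition even_mindex (n : nat) (l : multiindex n) : Prop :=
  forall i, ~~ odd (l i).

Definition multisequence (R : Type) (n : nat) : Type := multiindex n -> R.

(* R^n with its Borel sigma-algebra; the topology of 'rV[R]_n is that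
   of entrywise convergence, i.e. the usual one. *)
Definition borel_rV (R : realType) (n : nat) :=
  g_sigma_algebraType (@open 'rV[R]_n).

(* 0 ^+ 0 = 1, so a zero exponent always contributes the factor 1. *)
Definition monomial (R : realType) (n : nat) (x : 'rV[R]_n) (a : multiindex n)
    : R :=
  \prod_(i < n) x ord0 i ^+ a i.

Definition abs_monomial (R : realType) (n : nat) (x : 'rV[R]_n)
    (a : multiindex n) : R :=
  \prod_(i < n) `|x ord0 i| ^+ a i.

(* Measures are [0, +oo]-valued in the library, so nonnegativity is built in. *)
Definition moment_multisequence (R : realType) (n : nat)
    : set (multisequence R n) :=
  [set gamma | exists sigma : {measure set (borel_rV R n) -> \bar R},
    (forall a, (\int[sigma]_x (abs_monomial x a)%:E < +oo)%E) /\
    (forall a, (gamma a)%:E = (\int[sigma]_x (monomial x a)%:E)%E)].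

(* Main.v *)
Require Import Defs.
From HB Require Import structures.
From mathcomp Require Import all_boot all_order all_algebra.
From mathcomp Require Import all_classical all_reals all_analysis.
From mathcomp Require Import measurable_realfun.
Import Order.TTheory GRing.Theory Num.Theory.
Import numFieldNormedType.Exports.

Set Implicit Arguments.
Unset Strict Implicit.
Unset Printing Implicit Defensive.

Local Open Scope classical_set_scope.
Local Open Scope ring_scope.

Import HBNNSimple.

(** Let [sigma] represent [gamma], and let [phi x] have coordinates
    [x_i ^ d_i]. Then [x ^ (d a + l) = (phi x) ^ a * x ^ l], so that
      [gamma (d a + l) = \int (phi x) ^ a * x ^ l d sigma(x)].
    As every [l_i] is even, [x ^ l] is nonnegative and may be absorbed into the
    measure: the image [nu] under [phi] of the measure of density [x ^ l] with
    respect to [sigma] has [gamma (d a + l)] as its moment of index [a]. The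
    same computation with absolute values shows that its absolute moments are
    absolute moments of [sigma], hence finite.

    The measure [nu] and its change of variables formula come from
    [weighted_pushforward_exists]; its measurability hypotheses hold because
    [phi] and the coordinates are continuous. *)

Lemma integral_density_nnsfun (dT : measure_display) (T : measurableType dT)
    (R : realType) (mu nu : {measure set T -> \bar R}) (w : T -> \bar R)
    (h : {nnsfun T >-> R}) :
  measurable_fun setT w -> (forall x, 0 <= w x)%E ->
  (forall A, measurable A -> nu A = \int[mu]_(x in A) w x)%E ->
  (\int[nu]_x (h x)%:E = \int[mu]_x ((h x)%:E * w x))%E.
Proof.
move=> mw w0 nuE.
have mterm y : measurable_fun setT (fun x => (y * \1_(h @^-1` [set y]) x)%:E).
  exact/measurable_EFinP/measurable_funM.
rewrite integralT_nnsfun sintegralE.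
under [RHS]eq_integral => x _.
  rewrite fimfunE -fsumEFin// ge0_mule_fsuml; last first.
    by move=> y; exact: nnfun_muleindic_ge0.
  over.
rewrite ge0_integral_fsum//; last 2 first.
- by move=> y; exact: emeasurable_funM.
- by move=> y x _; rewrite mule_ge0// nnfun_muleindic_ge0.
(* On the level set of [h] at the value [y = h t], both sides are [y] times the
   integral of [w] over that set; writing [y] as [h t] shows [0 <= y]. *)
apply: eq_fsbigr => y /set_mem[t _ <-].
rewrite nuE//.
under [RHS]eq_integral do rewrite EFinM -muleA.
rewrite ge0_integralZl//; last 3 first.
- by apply: emeasurable_funM => //; exact/measurable_EFinP.
- by move=> x _; rewrite mule_ge0// lee_fin.
- by rewrite lee_fin.
congr (_ * _)%E.
rewrite [LHS]integral_mkcond; apply: eq_integral => x _.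
by rewrite epatch_indic muleC.
Qed.

(** Monotone convergence reduces the formula to simple functions. The density
    is real-valued so that multiplication by [w x] is continuous on [\bar R]:
    the limit along simple functions may then be taken under the product. *)
Lemma ge0_integral_density (dT : measure_display) (T : measurableType dT)
    (R : realType) (mu nu : {measure set T -> \bar R}) (w : T -> R)
    (f : T -> \bar R) :
  measurable_fun setT w -> (forall x, 0 <= w x) ->
  (forall A, measurable A -> nu A = \int[mu]_(x in A) (w x)%:E)%E ->
  measurable_fun setT f -> (forall x, 0 <= f x)%E ->
  (\int[nu]_x f x = \int[mu]_x (f x * (w x)%:E))%E.
Proof.
move=> mw w0 nuE mf f0.
have mw' : measurable_fun setT (EFin \o w) by exact/measurable_EFinP.
pose h := nnsfun_approx measurableT mf.
have hf x : (EFin \o h n) x @[n --> \oo] --> f x.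
  by apply: cvg_nnsfun_approx.
have ndh x : {homo (fun n => h n x) : m n / (m <= n)%N >-> m <= n}.
  by move=> m n mn; exact/lefP/nd_nnsfun_approx.
transitivity (limn (fun n => \int[nu]_x (h n x)%:E))%E.
  rewrite -monotone_convergence//.
  - by apply: eq_integral => x _; apply/esym/cvg_lim => //; exact: hf.
  - by move=> n; exact/measurable_EFinP.
  - by move=> n x _; rewrite lee_fin.
  - by move=> x _ m n mn; rewrite lee_fin; exact: ndh.
under eq_fun do rewrite (integral_density_nnsfun _ mw' _ nuE)//.
rewrite -monotone_convergence//.
- apply: eq_integral => x _; apply/cvg_lim => //.
  by apply: cvgeZr => //; exact: hf.
- by move=> n; apply: emeasurable_funM => //; exact/measurable_EFinP.
- by move=> n x _; rewrite mule_ge0// lee_fin.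
- by move=> x _ m n mn; rewrite lee_wpmul2r ?lee_fin//; exact: ndh.
Qed.

(** The measure is the pushforward under [phi] of the measure of density [w].
    The formula also covers signed functions: as [w] is nonnegative, multiplying
    by [w] commutes with taking positive and negative parts, which reduces a
    signed integrand to two nonnegative ones. *)
Lemma weighted_pushforward_exists (d1 d2 : measure_display)
    (X : measurableType d1) (Y : measurableType d2) (R : realType)
    (mu : {measure set X -> \bar R}) (w : X -> R) (phi : X -> Y) :
  measurable_fun setT w -> (forall x, 0 <= w x) -> measurable_fun setT phi ->
  exists nu : {measure set Y -> \bar R},
    forall f : Y -> \bar R, measurable_fun setT f ->
      (\int[nu]_y f y = \int[mu]_x (f (phi x) * (w x)%:E))%E.
Proof.
move=> mw w0 mphi.
have mw' : measurable_fun setT (EFin \o w) by exact/measurable_EFinP.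
pose rho0 (A : set X) := (\int[mu]_(x in A) (w x)%:E)%E.
have rho00 : rho0 set0 = 0%E by rewrite /rho0 integral_set0.
have rho0_ge0 A : (0 <= rho0 A)%E.
  by apply: integral_ge0 => x _; rewrite lee_fin.
have rho0_sigma : semi_sigma_additive rho0.
  by apply: semi_sigma_additive_nng_induced => // x; rewrite lee_fin.
pose rho_mixin := isMeasure.Build _ _ _ rho0 rho00 rho0_ge0 rho0_sigma.
pose rho : {measure set X -> \bar R} := HB.pack rho0 rho_mixin.
exists (pushforward rho phi).
have ge0E g : measurable_fun setT g -> (forall y, 0 <= g y)%E ->
    (\int[pushforward rho phi]_y g y = \int[mu]_x (g (phi x) * (w x)%:E))%E.
  move=> mg g0; rewrite ge0_integral_pushforward//.
  rewrite preimage_setT (ge0_integral_density (mu := mu) (w := w))//.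
  - exact: measurableT_comp.
  - by move=> x; exact: g0.
move=> f mf; rewrite integralE !ge0E//; last 2 first.
- exact: measurable_funeneg.
- exact: measurable_funepos.
rewrite [RHS]integralE; congr (_ - _)%E; apply: eq_integral => x _.
- by rewrite !funeposE maxe_pMl ?mul0e ?lee_fin.
- by rewrite !funenegE -mulNe maxe_pMl ?mul0e ?lee_fin.
(* The measurability of [phi] makes the pushforward a measure. *)
Unshelve. exact: mphi.
Qed.

Lemma measurable_continuous_borel_rV (R : realType) (n : nat)
    (f : 'rV[R]_n -> R) :
  continuous f -> measurable_fun setT (f : borel_rV R n -> R).
Proof.
move=> /continuousP cf; apply: (measurability _ (RGenOpens.measurableE R)).
move=> _ [_ [a [b ->] <-]]; rewrite setTI; apply: sub_gen_smallest.
exact/cf/interval_open.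
Qed.

Lemma measurable_borel_rV (R : realType) (n : nat)
    (f : 'rV[R]_n -> 'rV[R]_n) :
  continuous f -> measurable_fun setT (f : borel_rV R n -> borel_rV R n).
Proof.
move=> /continuousP cf.
apply: (@measurability _ _ _ (borel_rV R n) _ _ (@open 'rV[R]_n) erefl) => //.
by move=> _ [A oA <-]; rewrite setTI; apply: sub_gen_smallest; exact: cf.
Qed.

(** A uniform neighbourhood of a row imposes one condition per coordinate, and
    finitely many neighbourhoods of [x] can be intersected. *)
Lemma continuous_rowmx (R : realType) (n : nat) (T : topologicalType)
    (f : 'I_n -> T -> R) :
  (forall i, continuous (f i)) -> continuous (fun x => \row_i f i x).
Proof.
move=> cf x; apply/cvg_mx_entourageP => A entA.
have fA i : \forall y \near x, (f i x, f i y) \in A.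
  have /cvg_app_entourageP/(_ _ entA) := cf i x.
  by apply: filterS => y /mem_set.
by apply: filterS (filter_forall _ fA) => y fAy i j; rewrite !mxE.
Qed.

Definition coord_pow (R : realType) (n : nat) (d : multiindex n)
    (x : 'rV[R]_n) : 'rV[R]_n :=
  \row_i x ord0 i ^+ d i.

Lemma continuous_coord_pow (R : realType) (n : nat) (d : multiindex n) :
  continuous (@coord_pow R n d).
Proof.
apply: continuous_rowmx => i x.
apply: (@continuous_comp _ _ _ (fun y : 'rV[R]_n => y ord0 i)
  (fun t : R => t ^+ d i)).
  exact: coord_continuous.
exact: exprn_continuous.
Qed.

Lemma measurable_monomial (R : realType) (n : nat) (a : multiindex n) :
  measurable_fun setT (fun x : borel_rV R n => monomial x a).
Proof.
apply: measurable_prod => i _; apply: measurable_funX.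
apply: (@measurable_continuous_borel_rV R n (fun x => x ord0 i)).
exact: coord_continuous.
Qed.

Lemma abs_monomialE (R : realType) (n : nat) (x : 'rV[R]_n)
    (a : multiindex n) :
  abs_monomial x a = `|monomial x a|.
Proof. by rewrite normr_prod; apply: eq_bigr => i _; rewrite normrX. Qed.

Lemma monomial_even_ge0 (R : realType) (n : nat) (x : 'rV[R]_n)
    (l : multiindex n) :
  even_mindex l -> 0 <= monomial x l.
Proof. by move=> el; apply: prodr_ge0 => i _; exact: exprn_even_ge0. Qed.

Lemma monomial_coord_pow (R : realType) (n : nat) (x : 'rV[R]_n)
    (d a l : multiindex n) :
  monomial (coord_pow d x) a * monomial x l =
  monomial x (affine_mindex d a l).
Proof.
rewrite -big_split; apply: eq_bigr => i _ /=.
by rewrite mxE ffunE exprD exprM.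
Qed.

Theorem theorem3 (R : realType) (n : nat) (hn : (0 < n)%N)
    (d l : multiindex n) (hl : even_mindex l)
    (gamma : multisequence R n) :
  moment_multisequence gamma ->
  moment_multisequence
    ((fun a : multiindex n => gamma (affine_mindex d a l)) : multisequence R n).
Proof.
move=> [sigma [abs_fin gammaE]].
have [nu nuE] := weighted_pushforward_exists sigma
  (@measurable_monomial R n l) (fun x => monomial_even_ge0 x hl)
  (measurable_borel_rV (@continuous_coord_pow R n d)).
have mmon a : measurable_fun setT (fun x : borel_rV R n => (monomial x a)%:E).
  by apply/measurable_EFinP; exact: measurable_monomial.
exists nu; split=> a; last first.
  rewrite gammaE nuE//; apply: eq_integral => x _.
  by rewrite -EFinM monomial_coord_pow.
under eq_integral do rewrite abs_monomialE -abse_EFin.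
rewrite nuE; last exact: measurableT_comp.
under eq_integral => x _.
  rewrite /= -(ger0_norm (monomial_even_ge0 x hl)) -EFinM -normrM.
  rewrite monomial_coord_pow -abs_monomialE; over.
exact: abs_fin.
Qed.
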